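(* Let $I=(G=(V,E),\mathcal{C},\omega,\ell,b)$ be an instance of \textsc{Stars NWS} and $E^*\subseteq E$. Let $G'$ be a minimum solution for $I$, let $C\in\mathcal{C}$, and let $x\in\mathrm{univ}_{G'}(C)$ be such that there exists $\{y,z\}\in E^*$ with $\{y,z\}\subseteq C$ for which $x$ is not locally universal. Then $G'$ is not fitting for $E^*$.
   Context: A solution of \textsc{Stars NWS} is a spanning subgraph $G'=(V,E')$, $E'\subseteq E$, $|E'|\le\ell$, $\omega(E')\le b$, such that for every $C\in\mathcal{C}$ the set $\mathrm{univ}_{G'}(C)$ of vertices $u\in C$ adjacent in $G'$ to every vertex of $C\setminus\{u\}$ is nonempty; a minimum solution is one with the minimum number of edges. Edges of $E^*$ are called local edges. A vertex $v$ is locally universal for a set $A\subseteq V$ if $\{v,w\}\in E^*$ for every $w\in A\setminus\{v\}$. Two distinct communities $C_1,C_2$ induce a local cycle in $G'$ if there are $c_i\in\mathrm{univ}_{G'}(C_i)$ such that the graph on $C_1\cup C_2$ with edges $\{\{c_i,w\}: w\in C_i\setminus\{c_i\}, i\in\{1,2\}\}$ contains a cycle; each such cycle is a local cycle of $G'$. A minimum solution $G'$ is fitting for $E^*$ if $E^*\subseteq E(G')$ and each local cycle of $G'$ uses only edges of $E^*$. *)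

(* Defs.v *)
From HB Require Import structures.
From mathcomp Require Import all_boot all_order all_algebra.

Set Implicit Arguments.
Unset Strict Implicit.
Unset Printing Implicit Defensive.

Import Order.TTheory GRing.Theory Num.Theory.
Local Open Scope ring_scope.

(* Finite simple graphs on V; an edge {u, v} is the two-element set [set u; v].
   Spanning subgraphs of a graph are graphs on the same V. *)
Record graph (V : finType) := Graph {
  edges : {set {set V}};
  edges_card2 : forall e, e \in edges -> #|e| = 2
}.

Definition adj (V : finType) (G : graph V) : rel V :=
  fun u v => [set u; v] \in edges G.

(* Only the values of [weight] on the edges of [base] matter.  The weights range
   over the nonnegative elements of an arbitrary ordered domain R, which covers
   both natural (R = int) and real weights. *)
Record stars_nws (R : realDomainType) (V : finType) := StarsNWS {
  base : graph V;
  communities : {set {set V}};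
  weight : {set V} -> R;
  weight_ge0 : forall e, e \in edges base -> 0 <= weight e;
  edge_bound : nat;
  weight_bound : R
}.

Section StarsNWS.
Variables (R : realDomainType) (V : finType).
Implicit Types (I : stars_nws R V) (H : graph V) (C A : {set V}).
Implicit Types (F Estar : {set {set V}}) (s : seq V).

Definition univ H C : {set V} :=
  [set u in C | [forall w in C :\ u, adj H u w]].

Definition solution I H : Prop :=
  [/\ edges H \subset edges (base I),
      (#|edges H| <= edge_bound I)%N,
      \sum_(e in edges H) weight I e <= weight_bound I
    & forall C, C \in communities I -> univ H C != set0].

Definition minimum_solution I H : Prop :=
  solution I H /\
  forall H' : graph V, solution I H' -> (#|edges H| <= #|edges H'|)%N.

Definition locally_universal Estar (v : V) A : Prop :=
  forall w, w \in A :\ v -> [set v; w] \in Estar.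

Definition star_edges (c : V) C : {set {set V}} :=
  [set [set c; w] | w in C :\ c].

(* The sequence s lists the pairwise distinct vertices of a cycle (closing up
   from the last one to the first one) all of whose edges are in F. *)
Definition is_cycle F s : Prop :=
  (2 < size s)%N /\ ucycle (fun u v => [set u; v] \in F) s.

Definition cycle_edges s : {set {set V}} :=
  [set [set u; next s u] | u in s].

Definition induce_local_cycle H (C1 C2 : {set V}) s : Prop :=
  exists c1 c2, [/\ c1 \in univ H C1, c2 \in univ H C2
    & is_cycle (star_edges c1 C1 :|: star_edges c2 C2) s].

Definition local_cycle I H s : Prop :=
  exists C1 C2, [/\ C1 \in communities I, C2 \in communities I, C1 != C2
    & induce_local_cycle H C1 C2 s].

Definition fitting I Estar H : Prop :=
  [/\ minimum_solution I H, Estar \subset edges H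
    & forall s, local_cycle I H s -> cycle_edges s \subset Estar].

End StarsNWS.

(* Main.v *)
Require Import Defs.
From HB Require Import structures.
From mathcomp Require Import all_boot all_order all_algebra.

(** Suppose [G'] is fitting.  Then [x] lies outside [{y, z}], so [x y z] is a
    triangle of [G'].  By minimality the edge [{y, z}] cannot be deleted, hence
    some community [D] uses it in each of its spanning stars.  The star of [x]
    in [C] avoids [{y, z}], so [D] differs from [C], and the triangle is a local
    cycle of [C] and [D].  All its edges are then local, making [x] locally
    universal for [{y, z}]. *)

Import Order.TTheory GRing.Theory Num.Theory.
Local Open Scope ring_scope.

Section DeleteEdge.
Context {R : realDomainType} {V : finType}.
Implicit Types (I : stars_nws R V) (H : graph V) (e C : {set V}) (c w : V).

Lemma del_edge_card2 H e e' : e' \in edges H :\ e -> #|e'| = 2.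
Proof. by move/setD1P=> [_ /edges_card2]. Qed.

Definition del_edge H e : graph V := Graph (@del_edge_card2 H e).

Lemma univ_sub H C c : c \in univ H C -> c \in C.
Proof. by rewrite inE => /andP[]. Qed.

Lemma univ_adj H C c w : c \in univ H C -> w \in C -> w != c -> adj H c w.
Proof.
by rewrite inE => /andP[_ /forall_inP Hc] Cw cw; apply: Hc; rewrite !inE cw.
Qed.

Lemma mem_star_edges c C w : w \in C -> w != c -> [set c; w] \in star_edges c C.
Proof. by move=> Cw cw; apply: imset_f; rewrite !inE cw. Qed.

Lemma star_edges_center c C e : e \in star_edges c C -> c \in e.
Proof. by case/imsetP=> w _ ->; rewrite !inE eqxx. Qed.

(** Universality of [c] rests only on the edges of its star, and none of these is deleted. *)
Lemma univ_del_edge H e C c :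
  c \in univ H C -> e \notin star_edges c C -> c \in univ (del_edge H e) C.
Proof.
move=> uc Ne; rewrite inE (univ_sub _ _ _ uc) /=.
apply/forall_inP => w; rewrite in_setD1 => /andP[wc Cw].
rewrite /adj /= in_setD1 [_ \in edges H](univ_adj _ _ _ _ uc Cw wc) andbT.
by apply: contraNneq Ne => <-; apply: mem_star_edges.
Qed.

(** Otherwise every community has a center whose star avoids [e], so deleting [e] leaves a solution
    with one edge fewer. *)
Lemma minimum_solution_edge_needed I H e :
  minimum_solution I H -> e \in edges H ->
  exists2 C, C \in communities I &
    forall c, c \in univ H C -> e \in star_edges c C.
Proof.
move=> [[sHE leHl leHb unH] minH] He.
have [/exists_inP[C IC /forall_inP HC]|] :=
  boolP [exists C in communities I,
           [forall c in univ H C, e \in star_edges c C]].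
  by exists C.
rewrite negb_exists_in => /forall_inP noC.
suff /minH : solution I (del_edge H e).
  by rewrite [X in (X <= _)%N](cardsD1 e) He ltnn.
split.
- exact: subset_trans (subD1set _ _) sHE.
- exact: leq_trans (subset_leq_card (subD1set _ _)) leHl.
(* Since [e] has nonnegative weight, deleting it cannot exceed the weight bound. *)
- apply: le_trans leHb; rewrite [leRHS](big_setD1 e He) /= lerDr.
  exact/weight_ge0/(subsetP sHE).
- move=> C /noC; rewrite negb_forall_in => /exists_inP[c uc Ne].
  by apply/set0Pn; exists c; apply: univ_del_edge.
Qed.

End DeleteEdge.

Lemma triangle_cycle (V : finType) (F : {set {set V}}) (x y z : V) :
  uniq [:: x; y; z] ->
  [set x; y] \in F -> [set y; z] \in F -> [set z; x] \in F ->
  is_cycle F [:: x; y; z].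
Proof. by move=> U xy yz zx; split=> //; rewrite /ucycle /= xy yz zx. Qed.

Theorem lemma11 (R : realDomainType) (V : finType) (I : stars_nws R V)
    (Estar : {set {set V}}) (hE : Estar \subset edges (base I))
    (G' : graph V) (hG' : minimum_solution I G')
    (C : {set V}) (hC : C \in communities I)
    (x : V) (hx : x \in univ G' C)
    (hyz : exists y z : V, [/\ [set y; z] \in Estar, [set y; z] \subset C
       & ~ locally_universal Estar x [set y; z]]) :
  ~ fitting I Estar G'.
Proof.
case: hyz => y [z [Eyz sC nlu]] [_ sEG fit]; apply: nlu => w.
(* The target [w] is an endpoint of the local edge, and the two endpoints play symmetric roles. *)
wlog -> : y z Eyz sC / w = y.
  move=> IH; rewrite !inE => /andP[wx /orP[] /eqP ew].
    by apply: (IH y z) => //; rewrite !inE wx ew eqxx.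
  by apply: (IH z y); rewrite 1?setUC // !inE wx ew eqxx orbT.
rewrite in_setD1 => /andP[yx _].
(* If [z] is [x], the wanted edge is the given local edge itself. *)
have [<-|zx] := eqVneq z x; first by rewrite setUC.
have Gyz := subsetP sEG _ Eyz.
have yz : y != z by have := edges_card2 Gyz; rewrite cards2; case: (y != z).
have [Cy Cz] : y \in C /\ z \in C.
  by split; apply: (subsetP sC); rewrite !inE eqxx ?orbT.
have [D ID HD] := minimum_solution_edge_needed _ _ _ hG' Gyz.
(* If [D] were [C], the star of [x] would contain [[set y; z]], forcing [x] to be [y] or [z]. *)
have CD : C != D.
  apply/eqP=> CD; rewrite -CD in HD.
  have /star_edges_center := HD x hx.
  by rewrite !inE ![x == _]eq_sym (negPf yx) (negPf zx).
have [[_ _ _ /(_ D ID)/set0Pn[c uc]] _] := hG'.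
have /fit/subsetP : local_cycle I G' [:: x; y; z].
  (* The star of [x] in [C] supplies the two sides at [x]; the star of [c] in [D] supplies
     [[set y; z]]. *)
  exists C, D; split=> //; exists x, c; split=> //.
  apply: triangle_cycle; rewrite ?in_setU ?(HD c uc) ?orbT //.
  - by rewrite /= !inE negb_or ![x == _]eq_sym yx zx yz.
  - by rewrite mem_star_edges.
  - by rewrite [[set z; x]]setUC mem_star_edges.
(* The wanted edge joins [x] to its successor [y] on the cycle. *)
apply; apply/imsetP; exists x; first by rewrite !inE eqxx.
by rewrite /next /= eqxx.
Qed.
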